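(* Let $\lambda\in K$ and let $S\subseteq K\langle X;\Omega\rangle$, $\Omega=\{P,D\}$, be the set of $\Omega$-polynomials $P(x)P(y)-P(xP(y))-P(P(x)y)-\lambda P(xy)$, $D(xy)-D(x)y-xD(y)-\lambda D(x)D(y)$, $D(P(x))-x$ for $x,y\in\mathfrak{S}(X)$. Then $K\langle X;\Omega|S\rangle=K\langle X;\Omega\rangle/Id(S)$ is a free $\lambda$-differential Rota–Baxter algebra on the set $X$, with $K$-basis $\Phi(D^\omega(X))$.
   Context: $K$ is a commutative ring with unit. A $\lambda$-differential Rota–Baxter algebra is an associative $K$-algebra $R$ with $K$-linear $P,D:R\to R$ such that for all $x,y\in R$: $P(x)P(y)=P(xP(y))+P(P(x)y)+\lambda P(xy)$; $D(xy)=D(x)y+xD(y)+\lambda D(x)D(y)$; $D(P(x))=x$. Free on $X$ means every map from $X$ to such an algebra extends uniquely to an algebra homomorphism commuting with $P$ and $D$. $S(Y)$ free semigroup; $\mathfrak{S}_0=S(X)$, $\mathfrak{S}_n=S(X\cup\{P(u),D(u)\mid u\in\mathfrak{S}_{n-1}\})$, $\mathfrak{S}(X)=\bigcup_n\mathfrak{S}_n$; $K\langle X;\Omega\rangle$ is the free $K$-module on $\mathfrak{S}(X)$ with concatenation product and $P,D$ extended linearly; $Id(S)$ is the $K$-span of all $u|_s$, $u$ a word on $X\cup\{\star\}$ with exactly one $\star$, $s\in S$ substituted for $\star$. $D^\omega(X)=\{D^i(x)\mid i\ge0,x\in X\}$, $D^0(x)=x$. For $Y,Z\subseteq\mathfrak{S}(X)$: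 $\Lambda^P(Y,Z)=\bigcup_{r\ge1}(YP(Z))^r\cup\bigcup_{r\ge0}(YP(Z))^rY\cup\bigcup_{r\ge1}(P(Z)Y)^r\cup\bigcup_{r\ge0}(P(Z)Y)^rP(Z)$; $\Phi_0=S(D^\omega(X))$, $\Phi_n=\Lambda^P(\Phi_0,\Phi_{n-1})$, $\Phi(D^\omega(X))=\bigcup_{n\ge0}\Phi_n$. *)

(* Defs.v *)
From HB Require Import structures.
From mathcomp Require Import all_boot all_algebra.
From Stdlib Require Import ClassicalEpsilon.
Set Implicit Arguments. Unset Strict Implicit. Unset Printing Implicit Defensive.
Import GRing.Theory.
Local Open Scope ring_scope.

(* A letter is either x in X, or P(w), or D(w) with w a (nonempty) word.
   A (nonempty) word is a head letter followed by a list of letters. *)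
Inductive letter (X : Type) : Type :=
  | Lx of X
  | LP of letter X & seq (letter X)
  | LD of letter X & seq (letter X).
Arguments Lx {X}. Arguments LP {X}. Arguments LD {X}.

Definition word (X : Type) := (letter X * seq (letter X))%type.

Section Words.
Variable X : Type.
Implicit Types (u v w : word X) (l r : seq (letter X)).

Definition wletters w : seq (letter X) := w.1 :: w.2.
Definition wcat u v : word X := (u.1, u.2 ++ wletters v).
Definition wx (x : X) : word X := (Lx x, [::]).
Definition wP w : word X := (LP w.1 w.2, [::]).
Definition wD w : word X := (LD w.1 w.2, [::]).
Definition lmulw l w : word X :=
  if l is a :: l' then (a, l' ++ wletters w) else w.
Definition rmulw w r : word X := (w.1, w.2 ++ r).

Fixpoint Dpow (i : nat) (x : X) : letter X :=
  if i is i'.+1 then LD (Dpow i' x) [::] else Lx x.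
(* D^omega(X) consists of the one-letter words D^i(x);
   Phi_0 = S(D^omega(X)) consists of the words all of whose letters are such *)
Definition Phi0 w : Prop :=
  forall a, List.In a (wletters w) -> exists i x, a = Dpow i x.

(* Lambda^P(Y,Z): nonempty alternating concatenations of words of Y and
   words P(z), z in Z (the union of the four families in the paper). *)
Inductive blk := BY of word X | BPz of word X.
Definition blk_isY (b : blk) := if b is BY _ then true else false.
Definition blk_letters (b : blk) : seq (letter X) :=
  match b with BY y => wletters y | BPz z => wletters (wP z) end.
Fixpoint alternating (bs : seq blk) : bool :=
  match bs with
  | b1 :: ((b2 :: _) as bs') => (blk_isY b1 != blk_isY b2) && alternating bs'
  | _ => true
  end.
Definition LambdaP (Y Z : word X -> Prop) w : Prop :=
  exists bs : seq blk, bs <> [::] /\ alternating bs /\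
    (forall b, List.In b bs ->
       match b with BY y => Y y | BPz z => Z z end) /\
    flatten (map blk_letters bs) = wletters w.
Fixpoint Phin (n : nat) : word X -> Prop :=
  if n is n'.+1 then LambdaP Phi0 (Phin n') else Phi0.
Definition Phi w : Prop := exists n, Phin n w.

(* CTop l r   = l * star * r
   CinP l r c = l P(c) r,   CinD l r c = l D(c) r   (l, r possibly empty) *)
Inductive ctx :=
  | CTop of seq (letter X) & seq (letter X)
  | CinP of seq (letter X) & seq (letter X) & ctx
  | CinD of seq (letter X) & seq (letter X) & ctx.
Fixpoint csubw (c : ctx) w : word X :=
  match c with
  | CTop l r => lmulw l (rmulw w r)
  | CinP l r c' => lmulw l (rmulw (wP (csubw c' w)) r)
  | CinD l r c' => lmulw l (rmulw (wD (csubw c' w)) r)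
  end.
End Words.

Section Polys.
Variables (K : comPzRingType) (X : Type).
Definition opoly := seq (K * word X).
Implicit Types (p q : opoly) (u v w : word X).

Definition weqb u v : bool :=
  if excluded_middle_informative (u = v) then true else false.
Definition coef p w : K := \sum_(a <- p) (if weqb a.2 w then a.1 else 0).
(* equality in the free module K<X;Omega> *)
Definition peq p q : Prop := forall w, coef p w = coef q w.

Definition pword w : opoly := [:: (1, w)].
Definition pscale (k : K) p : opoly := [seq (k * a.1, a.2) | a <- p].
Definition padd p q : opoly := p ++ q.
Definition psub p q : opoly := p ++ pscale (-1) q.
Definition pmul p q : opoly := [seq (a.1 * b.1, wcat a.2 b.2) | a <- p, b <- q].
Definition pP p : opoly := [seq (a.1, wP a.2) | a <- p].
Definition pD p : opoly := [seq (a.1, wD a.2) | a <- p].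
Definition psubst (c : ctx X) p : opoly := [seq (a.1, csubw c a.2) | a <- p].

Variable lam : K.
Definition rb_poly (x y : word X) : opoly :=
  [:: (1, wcat (wP x) (wP y)); (-1, wP (wcat x (wP y)));
      (-1, wP (wcat (wP x) y)); (- lam, wP (wcat x y))].
Definition dl_poly (x y : word X) : opoly :=
  [:: (1, wD (wcat x y)); (-1, wcat (wD x) y);
      (-1, wcat x (wD y)); (- lam, wcat (wD x) (wD y))].
Definition dp_poly (x : word X) : opoly := [:: (1, wD (wP x)); (-1, x)].
Definition inS (s : opoly) : Prop :=
  exists x y, s = rb_poly x y \/ s = dl_poly x y \/ s = dp_poly x.

Definition inId p : Prop :=
  exists g : seq (K * ctx X * opoly),
    (forall t, List.In t g -> inS t.2) /\
    peq p (flatten [seq pscale t.1.1 (psubst t.1.2 t.2) | t <- g]).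
End Polys.
Arguments pword {K X} w.

Definition is_lamDRB (K : comPzRingType) (lam : K) (A : lmodType K)
    (mul : A -> A -> A) (P D : A -> A) : Prop :=
  ((forall x y z, mul x (mul y z) = mul (mul x y) z) /\
      (forall (k : K) x y z, mul (k *: x + y) z = k *: mul x z + mul y z) /\
      (forall (k : K) x y z, mul z (k *: x + y) = k *: mul z x + mul z y) /\
      (forall (k : K) x y, P (k *: x + y) = k *: P x + P y) /\
      (forall (k : K) x y, D (k *: x + y) = k *: D x + D y) /\
      (forall x y, mul (P x) (P y) = P (mul x (P y)) + P (mul (P x) y) + lam *: P (mul x y)) /\
      (forall x y, D (mul x y) = mul (D x) y + mul x (D y) + lam *: mul (D x) (D y)) /\
      (forall x, D (P x) = x)).

Definition pext (K : comPzRingType) (X : Type) (A : lmodType K)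
    (phi : word X -> A) (p : opoly K X) : A := \sum_(a <- p) a.1 *: phi a.2.

(* phi : words -> A induces an algebra homomorphism K<X;Omega>/Id(S) -> A
   commuting with P and D *)
Definition quot_hom (K : comPzRingType) (lam : K) (X : Type) (A : lmodType K)
    (mul : A -> A -> A) (P D : A -> A) (phi : word X -> A) : Prop :=
  [/\ (forall u v, phi (wcat u v) = mul (phi u) (phi v)),
      (forall u, phi (wP u) = P (phi u)),
      (forall u, phi (wD u) = D (phi u)) &
      (forall p, inId lam p -> pext phi p = 0)].

(* Main.v *)
Require Import Defs.
From HB Require Import structures.
From mathcomp Require Import all_boot all_algebra boolp zify.
From Stdlib Require Import ClassicalEpsilon.
Set Implicit Arguments. Unset Strict Implicit. Unset Printing Implicit Defensive.
Import GRing.Theory.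
Local Open Scope ring_scope.

(** A weight-[lam] differential Rota-Baxter algebra is the same thing as a weight-[lam] differential
    algebra [(A, D)] with a subalgebra [C] on which [D] restricts to a bijection [C -> A]: then
    [P] is the inverse of [D] on [C], and the Rota-Baxter identity is the Leibniz rule applied to
    [P x * P y], which lies in [C].

    For the independence of [Phi] such a pair is built on a free associative algebra [U]. Its
    generators are letters [x_i] standing for [D^i x], with [D x_i = x_(i+1)], and letters [q]
    with [D q = w], one for each word [w] which either begins with some [x_i] or is a single
    letter [q']; [C] is generated by the letters [q]. Every nonempty word is uniquely [m w] with
    [m] a word in the [q]'s and [w] as above, and [D (m q) = m w + D m q + lam D m w] shows that
    [D] is triangular, hence bijective, from [C] to [U]. A linear map [gam] from [U] to the span
    of all words sends the value in [U] of any word of [Phi] back to that word.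

    Spanning is shown by rewriting: words of [Phi] are those in which [D] is only applied to
    [D^i x] and no two letters [P u], [P v] are adjacent. *)

(** * Linear maps and free modules *)

Section Linear.
Variable K : comPzRingType.
Implicit Types A B C V : lmodType K.

Definition lin A B (f : A -> B) := forall (k : K) x y, f (k *: x + y) = k *: f x + f y.

Lemma linD A B (f : A -> B) : lin f -> forall x y, f (x + y) = f x + f y.
Proof. by move=> lf x y; have := lf 1 x y; rewrite !scale1r. Qed.

Lemma lin0 A B (f : A -> B) : lin f -> f 0 = 0.
Proof. by move=> lf; apply: (addIr (f 0)); rewrite -linD // !add0r. Qed.

Lemma linZ A B (f : A -> B) : lin f -> forall k x, f (k *: x) = k *: f x.
Proof. by move=> lf k x; have := lf k x 0; rewrite (lin0 lf) !addr0. Qed.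

Lemma linN A B (f : A -> B) : lin f -> forall x, f (- x) = - f x.
Proof. by move=> lf x; rewrite -scaleN1r linZ // scaleN1r. Qed.

Lemma lin_sum A B (f : A -> B) : lin f ->
  forall (I : Type) (s : seq I) (F : I -> A), f (\sum_(i <- s) F i) = \sum_(i <- s) f (F i).
Proof.
move=> lf I s F; elim: s => [|i s IH]; first by rewrite !big_nil lin0.
by rewrite !big_cons linD // IH.
Qed.

Lemma lin_id A : lin (fun x : A => x). Proof. by []. Qed.

Lemma lin_comp A B C (g : B -> C) (f : A -> B) : lin g -> lin f -> lin (fun x => g (f x)).
Proof. by move=> lg lf k x y; rewrite lf lg. Qed.

Lemma lin_add A B (f g : A -> B) : lin f -> lin g -> lin (fun x => f x + g x).
Proof. by move=> lf lg k x y; rewrite lf lg scalerDr addrACA. Qed.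

Lemma lin_scale A B c (f : A -> B) : lin f -> lin (fun x => c *: f x).
Proof. by move=> lf k x y; rewrite lf scalerDr !scalerA mulrC. Qed.

Lemma lin_opp A B (f : A -> B) : lin f -> lin (fun x => - f x).
Proof. by move=> lf k x y; rewrite lf opprD scalerN. Qed.

(** Being inductive, membership in a span lets linear statements be checked on generators, with no
    finite sums to handle. *)
Inductive lspan V (S : V -> Prop) : V -> Prop :=
  | lspan0 : lspan S 0
  | lspan_gen v : S v -> lspan S v
  | lspanD u v : lspan S u -> lspan S v -> lspan S (u + v)
  | lspanZ k v : lspan S v -> lspan S (k *: v).

Lemma lspanN V (S : V -> Prop) v : lspan S v -> lspan S (- v).
Proof. by rewrite -scaleN1r; apply: lspanZ. Qed.

Lemma lspanB V (S : V -> Prop) u v : lspan S u -> lspan S v -> lspan S (u - v).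
Proof. by move=> su sv; apply: lspanD => //; apply: lspanN. Qed.

Lemma lspan_sum V (S : V -> Prop) (I : Type) (s : seq I) (F : I -> V) :
  (forall i, List.In i s -> lspan S (F i)) -> lspan S (\sum_(i <- s) F i).
Proof.
elim: s => [|i s IH] H; first by rewrite big_nil; exact: lspan0.
rewrite big_cons; apply: lspanD; first by apply: H; left.
by apply: IH => j js; apply: H; right.
Qed.

Lemma lspan_lin A B (S : A -> Prop) (S' : B -> Prop) (f : A -> B) : lin f ->
  (forall v, S v -> lspan S' (f v)) -> forall v, lspan S v -> lspan S' (f v).
Proof.
move=> lf H v; elim=> {v} [|v /H //|u v _ su _ sv|k v _ sv].
- by rewrite lin0 //; apply: lspan0.
- by rewrite linD //; apply: lspanD.
- by rewrite linZ //; apply: lspanZ.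
Qed.

Lemma lspan_sub V (S S' : V -> Prop) :
  (forall v, S v -> lspan S' v) -> forall v, lspan S v -> lspan S' v.
Proof. exact: (@lspan_lin V V S S' _ (@lin_id V)). Qed.

Lemma lspan_eq A B (S : A -> Prop) (f g : A -> B) : lin f -> lin g ->
  (forall v, S v -> f v = g v) -> forall v, lspan S v -> f v = g v.
Proof.
move=> lf lg H v; elim=> {v} [|v /H //|u v _ su _ sv|k v _ sv].
- by rewrite !lin0.
- by rewrite !linD // su sv.
- by rewrite !linZ // sv.
Qed.

End Linear.

(** * Free modules as finitely supported coefficient functions, and their products *)

Section FreeModule.
Variables (K : comPzRingType) (T : Type).
Implicit Types (p q : seq (K * T)) (t u : T).

(** Equality on the basis is decided classically. The body is that of [weqb], so on words [coef] and
    [pext] are convertible to [gcoef] and [gext]. *)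
Definition eqT t u : bool := if excluded_middle_informative (t = u) then true else false.

Lemma eqTP t u : reflect (t = u) (eqT t u).
Proof. by rewrite /eqT; case: excluded_middle_informative => H; constructor. Qed.

Definition gcoef p t : K := \sum_(a <- p) (if eqT a.2 t then a.1 else 0).
Definition gext (A : lmodType K) (f : T -> A) p : A := \sum_(a <- p) a.1 *: f a.2.

Lemma gcoef_cat p q t : gcoef (p ++ q) t = gcoef p t + gcoef q t.
Proof. by rewrite /gcoef big_cat. Qed.

Lemma gcoef_scale k p t : gcoef [seq (k * a.1, a.2) | a <- p] t = k * gcoef p t.
Proof.
rewrite /gcoef big_map mulr_sumr; apply: eq_bigr => a _ /=.
by case: ifP => _ //; rewrite mulr0.
Qed.

Lemma gext_cat (A : lmodType K) (f : T -> A) p q : gext f (p ++ q) = gext f p + gext f q.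
Proof. by rewrite /gext big_cat. Qed.

Lemma gext_scale (A : lmodType K) (f : T -> A) k p :
  gext f [seq (k * a.1, a.2) | a <- p] = k *: gext f p.
Proof.
by rewrite /gext big_map scaler_sumr; apply: eq_bigr => a _ /=; rewrite scalerA.
Qed.

Lemma gext_split (A : lmodType K) (f : T -> A) t p :
  gext f p = gcoef p t *: f t + gext f [seq a <- p | ~~ eqT a.2 t].
Proof.
elim: p => [|a p IH]; first by rewrite /gext /gcoef !big_nil scale0r addr0.
rewrite /gext /gcoef /= !big_cons -/(gext f p) -/(gcoef p t) IH.
case: eqTP => [->|_] /=; first by rewrite scalerDl addrA.
by rewrite add0r big_cons addrCA.
Qed.

Lemma gcoef_filter t u p :
  gcoef [seq a <- p | ~~ eqT a.2 t] u = if eqT u t then 0 else gcoef p u.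
Proof.
elim: p => [|a p IH]; first by rewrite /gcoef !big_nil if_same.
rewrite /gcoef /= big_cons -/(gcoef p u).
case: (eqTP a.2 t) => [at_|nat_] /=; rewrite ?big_cons -/(gcoef _ u) IH.
  case: (eqTP u t) => [//|nut]; case: (eqTP a.2 u) => [au|_]; last by rewrite add0r.
  by case: nut; rewrite -au.
case: (eqTP u t) => [ut|//]; case: (eqTP a.2 u) => [au|_]; last by rewrite addr0.
by case: nat_; rewrite au.
Qed.

(** Strong induction on the length: the terms over the basis element of the head are collected by
    [gext_split] and cancel; the rest is shorter and still has zero coefficients. *)
Lemma gext_eq0 (A : lmodType K) (f : T -> A) p : (forall t, gcoef p t = 0) -> gext f p = 0.
Proof.
have [n] := ubnP (size p); elim: n p => // n IH [|a p] /=; first by rewrite /gext big_nil.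
rewrite ltnS => szp H; rewrite (gext_split f a.2) H scale0r add0r /=.
case: eqTP => // _ /=; apply: IH => [|t].
  by apply: leq_ltn_trans szp; rewrite size_filter count_size.
have := gcoef_filter a.2 t (a :: p); rewrite /=; case: (eqTP a.2 a.2) => // _ /= ->.
by rewrite H if_same.
Qed.

Lemma gext_ext (A : lmodType K) (f : T -> A) p q :
  (forall t, gcoef p t = gcoef q t) -> gext f p = gext f q.
Proof.
move=> H; apply/eqP; rewrite -subr_eq0 -scaleN1r -gext_scale -gext_cat; apply/eqP.
by apply: gext_eq0 => t; rewrite gcoef_cat gcoef_scale H mulN1r subrr.
Qed.

(** Storing the coefficient function instead of a list makes equality in the free module Leibniz
    equality; the propositional field expresses finite support. *)
Record fmod := Fmod { fcoef :> T -> K; _ : exists p, forall t, fcoef t = gcoef p t }.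

Lemma fmodP (a b : fmod) : (forall t, a t = b t) -> a = b.
Proof.
case: a b => [a pa] [b pb] /= H; have E : a = b by apply: funext.
by case: _ / E pb => pb; congr Fmod; apply: Prop_irrelevance.
Qed.

HB.instance Definition _ := gen_eqMixin fmod.
HB.instance Definition _ := gen_choiceMixin fmod.

Definition fmod_of p : fmod := Fmod (ex_intro _ p (fun t => erefl (gcoef p t))).

Lemma fmod_list (a : fmod) : { p | forall t, a t = gcoef p t }.
Proof. by apply: constructive_indefinite_description; case: a. Qed.

Definition fmod_rep (a : fmod) : seq (K * T) := sval (fmod_list a).

Lemma fmod_repE (a : fmod) t : gcoef (fmod_rep a) t = a t.
Proof. by rewrite /fmod_rep; case: fmod_list. Qed.

Definition fmod_zero := fmod_of [::].
Definition fmod_add (a b : fmod) := fmod_of (fmod_rep a ++ fmod_rep b).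
Definition fmod_scale k (a : fmod) := fmod_of [seq (k * c.1, c.2) | c <- fmod_rep a].

Lemma fmod_zeroE t : fmod_zero t = 0. Proof. exact: big_nil. Qed.
Lemma fmod_addE a b t : fmod_add a b t = a t + b t.
Proof. by rewrite /= gcoef_cat !fmod_repE. Qed.
Lemma fmod_scaleE k a t : fmod_scale k a t = k * a t.
Proof. by rewrite /= gcoef_scale fmod_repE. Qed.
Definition fmodE := (fmod_zeroE, fmod_addE, fmod_scaleE).

Fact fmod_addA : associative fmod_add.
Proof. by move=> a b c; apply: fmodP => t; rewrite !fmodE addrA. Qed.
Fact fmod_addC : commutative fmod_add.
Proof. by move=> a b; apply: fmodP => t; rewrite !fmodE addrC. Qed.
Fact fmod_add0 : left_id fmod_zero fmod_add.
Proof. by move=> a; apply: fmodP => t; rewrite !fmodE add0r. Qed.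
Fact fmod_addN : left_inverse fmod_zero (fmod_scale (-1)) fmod_add.
Proof. by move=> a; apply: fmodP => t; rewrite !fmodE mulN1r addNr. Qed.
HB.instance Definition _ :=
  GRing.isZmodule.Build fmod fmod_addA fmod_addC fmod_add0 fmod_addN.

Fact fmod_scaleA k l a : fmod_scale k (fmod_scale l a) = fmod_scale (k * l) a.
Proof. by apply: fmodP => t; rewrite !fmodE mulrA. Qed.
Fact fmod_scale1 : left_id 1 fmod_scale.
Proof. by move=> a; apply: fmodP => t; rewrite !fmodE mul1r. Qed.
Fact fmod_scaleDr : right_distributive fmod_scale +%R.
Proof. by move=> k a b; apply: fmodP => t; rewrite !fmodE mulrDr. Qed.
Fact fmod_scaleDl a : {morph fmod_scale^~ a : k l / k + l}.
Proof. by move=> k l; apply: fmodP => t; rewrite !fmodE mulrDl. Qed.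
HB.instance Definition _ :=
  GRing.Zmodule_isLmodule.Build K fmod fmod_scaleA fmod_scale1 fmod_scaleDr fmod_scaleDl.

Definition delta t : fmod := fmod_of [:: (1, t)].

(** The linear extension of [f] is computed on a chosen list; by [gext_ext] the choice does not
    matter. *)
Definition ext (A : lmodType K) (f : T -> A) (a : fmod) : A := gext f (fmod_rep a).

Lemma lin_ext (A : lmodType K) (f : T -> A) : lin (ext f).
Proof.
move=> k a b; rewrite /ext -gext_scale -gext_cat; apply: gext_ext => t.
by rewrite gcoef_cat gcoef_scale !fmod_repE [LHS]fmod_addE fmod_scaleE.
Qed.

Lemma ext_e (A : lmodType K) (f : T -> A) t : ext f (delta t) = f t.
Proof.
rewrite /ext (@gext_ext _ _ _ [:: (1, t)]) => [|u]; first by rewrite /gext big_seq1 scale1r.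
by rewrite fmod_repE.
Qed.

Lemma lin_ext_comp (A B : lmodType K) (f : T -> A) (g : B -> fmod) :
  lin g -> lin (fun x => ext f (g x)).
Proof. exact: (lin_comp (@lin_ext A f)). Qed.

Lemma ext_linP (A : lmodType K) (f g : T -> A) k a :
  ext (fun t => k *: f t + g t) a = k *: ext f a + ext g a.
Proof.
rewrite /ext /gext scaler_sumr -big_split; apply: eq_bigr => c _ /=.
by rewrite scalerDr !scalerA mulrC.
Qed.

Lemma lin_fcoef t : lin (fun a : fmod => a t : K^o).
Proof. by move=> k a b; rewrite [LHS]fmod_addE fmod_scaleE. Qed.

Lemma e_coef t u : delta t u = if eqT t u then 1 else 0.
Proof. by rewrite /= /gcoef big_seq1. Qed.

Lemma gext_coef p t : gext delta p t = gcoef p t.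
Proof.
rewrite /gext (lin_sum (lin_fcoef t)); apply: eq_bigr => a _.
by rewrite (linZ (lin_fcoef t)) e_coef /=; case: ifP => _; [exact: mulr1|exact: mulr0].
Qed.

Lemma fmod_sum a : a = gext delta (fmod_rep a).
Proof. by apply: fmodP => t; rewrite gext_coef fmod_repE. Qed.

Definition bspan (R : T -> Prop) := lspan (fun v : fmod => exists2 t, R t & v = delta t).

Lemma bspan_e (R : T -> Prop) t : R t -> bspan R (delta t).
Proof. by move=> Rt; apply: lspan_gen; exists t. Qed.

Lemma bspan_all (R : T -> Prop) : (forall t, R t) -> forall a, bspan R a.
Proof.
move=> H a; rewrite (fmod_sum a); apply: lspan_sum => i _; apply: lspanZ.
exact: bspan_e.
Qed.

Lemma bspan_lin (R : T -> Prop) (B : lmodType K) (S' : B -> Prop) (f : fmod -> B) : lin f ->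
  (forall t, R t -> lspan S' (f (delta t))) -> forall v, bspan R v -> lspan S' (f v).
Proof. by move=> lf H; apply: lspan_lin => // _ [t Rt ->]; apply: H. Qed.

Lemma bspan_eq (R : T -> Prop) (B : lmodType K) (f g : fmod -> B) : lin f -> lin g ->
  (forall t, R t -> f (delta t) = g (delta t)) -> forall v, bspan R v -> f v = g v.
Proof. by move=> lf lg H; apply: lspan_eq => // _ [t Rt ->]; apply: H. Qed.

Lemma lin_eq (B : lmodType K) (f g : fmod -> B) : lin f -> lin g ->
  (forall t, f (delta t) = g (delta t)) -> forall v, f v = g v.
Proof.
move=> lf lg H v; apply: (@bspan_eq (fun=> True)) => //; exact: bspan_all.
Qed.

Section Product.
Variable op : T -> T -> T.

Definition fmul (a b : fmod) : fmod := ext (fun u => ext (fun v => delta (op u v)) b) a.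

Lemma fmul_e u v : fmul (delta u) (delta v) = delta (op u v).
Proof. by rewrite /fmul !ext_e. Qed.

Lemma lin_fmull b : lin (fmul^~ b). Proof. exact: lin_ext. Qed.

Lemma lin_fmulr a : lin (fmul a).
Proof.
move=> k x y; rewrite /fmul -ext_linP; congr (ext _ a); apply: funext => u.
exact: lin_ext.
Qed.

Lemma lin_fmull_comp (A : lmodType K) b (f : A -> fmod) : lin f -> lin (fun x => fmul (f x) b).
Proof. exact: (lin_comp (lin_fmull b)). Qed.

Lemma lin_fmulr_comp (A : lmodType K) a (f : A -> fmod) : lin f -> lin (fun x => fmul a (f x)).
Proof. exact: (lin_comp (lin_fmulr a)). Qed.

Lemma fmul0l b : fmul 0 b = 0. Proof. exact: (lin0 (lin_fmull b)). Qed.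
Lemma fmul0r a : fmul a 0 = 0. Proof. exact: (lin0 (lin_fmulr a)). Qed.
Lemma fmulDl b x y : fmul (x + y) b = fmul x b + fmul y b.
Proof. exact: (linD (lin_fmull b)). Qed.
Lemma fmulDr a x y : fmul a (x + y) = fmul a x + fmul a y.
Proof. exact: (linD (lin_fmulr a)). Qed.
Lemma fmulZl b k x : fmul (k *: x) b = k *: fmul x b.
Proof. exact: (linZ (lin_fmull b)). Qed.
Lemma fmulZr a k x : fmul a (k *: x) = k *: fmul a x.
Proof. exact: (linZ (lin_fmulr a)). Qed.

Lemma fmulA : associative op -> associative fmul.
Proof.
move=> opA a b c.
apply: (@lin_eq _ (fun x => fmul x (fmul b c)) (fun x => fmul (fmul x b) c)) => [||u].
- exact: lin_fmull.
- exact: (lin_comp (lin_fmull _) (lin_fmull _)).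
apply: (@lin_eq _ (fun x => fmul _ (fmul x c)) (fun x => fmul (fmul _ x) c)) => [||v].
- exact: (lin_comp (lin_fmulr _) (lin_fmull _)).
- exact: (lin_comp (lin_fmull _) (lin_fmulr _)).
apply: (@lin_eq _ (fun x => fmul _ (fmul _ x)) (fun x => fmul (fmul _ _) x)) => [||w].
- exact: (lin_comp (lin_fmulr _) (lin_fmulr _)).
- exact: lin_fmulr.
by rewrite !fmul_e opA.
Qed.

Lemma bspan_fmul (R1 R2 R : T -> Prop) :
  (forall t u, R1 t -> R2 u -> R (op t u)) ->
  forall a b, bspan R1 a -> bspan R2 b -> bspan R (fmul a b).
Proof.
move=> H a b ha hb; apply: (bspan_lin (lin_fmull b) _ ha) => t R1t.
apply: (bspan_lin (lin_fmulr (delta t)) _ hb) => u R2u.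
by rewrite fmul_e; apply: bspan_e; apply: H.
Qed.

End Product.
End FreeModule.

Ltac lin_tac := repeat first
  [ exact: lin_id | exact: lin_ext | exact: lin_fmull | exact: lin_fmulr
  | apply: lin_add | apply: lin_opp | apply: lin_scale
  | apply: lin_fmull_comp | apply: lin_fmulr_comp | apply: lin_ext_comp ].

(** * A differential Rota-Baxter algebra on a free associative algebra *)

(* [Qx y l] and [Qp q] are the letters whose derivatives are the words [y l] and [q]. *)
Inductive pgen (X : Type) : Type :=
  | Qx of (nat * X) & seq ((nat * X) + pgen X)
  | Qp of pgen X.
Arguments Qx {X}. Arguments Qp {X}.

Section Model.
Variables (K : comPzRingType) (lam : K) (X : Type).

Definition gen := ((nat * X) + pgen X)%type.
Implicit Types (q : pgen X) (m : seq (pgen X)) (g : gen) (l t u v : seq gen).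

Definition wl q : seq gen := match q with Qx y l => inl y :: l | Qp q' => [:: inr q'] end.

(** The weight of a letter [q] is one more than that of its derivative [wl q], so differentiating
    [q] lowers the weight. The sum is inlined because [wt] is defined from [qwt]. *)
Fixpoint qwt q : nat := match q with
  | Qx _ l => (sumn (map (fun g => if g is inr q' then qwt q' else 1%N) l)).+2
  | Qp q' => (qwt q').+1
  end.
Definition gwt g : nat := if g is inr q then qwt q else 1%N.
Definition wt l : nat := sumn (map gwt l).

Lemma wt_cat u v : wt (u ++ v) = (wt u + wt v)%N.
Proof. by rewrite /wt map_cat sumn_cat. Qed.

Lemma qwt_wl q : qwt q = (wt (wl q)).+1.
Proof. by case: q => [y l|q] //=; rewrite /wt /= addn0. Qed.

Definition pword_of m : seq gen := map inr m.

Local Notation U := (fmod K (seq gen)).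
Local Notation "a ** b" := (fmul cat a b) (at level 40, left associativity).
Local Notation delta := (@delta K (seq gen)).

Lemma umulA : associative (fmul cat : U -> U -> U).
Proof. by apply: fmulA; apply: catA. Qed.

Lemma umul1 (a : U) : delta [::] ** a = a.
Proof. by apply: (@lin_eq _ _ _ (fun a => delta [::] ** a) id); lin_tac => t; rewrite fmul_e. Qed.

Lemma umulr1 (a : U) : a ** delta [::] = a.
Proof. by apply: (@lin_eq _ _ _ (fun a => a ** delta [::]) id); lin_tac => t; rewrite fmul_e cats0. Qed.

Lemma e_cons g l : delta (g :: l) = delta [:: g] ** delta l. Proof. by rewrite fmul_e. Qed.

Definition dgen g : U :=
  match g with inl y => delta [:: inl (y.1.+1, y.2)] | inr q => delta (wl q) end.

Fixpoint dmon l : U :=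
  if l is g :: l' then dgen g ** delta l' + delta [:: g] ** dmon l' + lam *: (dgen g ** dmon l')
  else 0.

Definition uD : U -> U := ext dmon.

Lemma lin_uD : lin uD. Proof. exact: lin_ext. Qed.

Lemma uD_e l : uD (delta l) = dmon l. Proof. exact: ext_e. Qed.

(** [dmon] applies the weighted Leibniz rule to the first letter only; associativity extends it to
    every factorisation. *)
Lemma dmon_cat u v : dmon (u ++ v) = dmon u ** delta v + delta u ** dmon v + lam *: (dmon u ** dmon v).
Proof.
elim: u => [|g u IH] /=; first by rewrite !fmul0l scaler0 addr0 umul1 add0r.
rewrite IH (e_cons g u) -fmul_e !(fmulDl, fmulDr, fmulZl, fmulZr, scalerDr) !umulA !addrA.
by rewrite [LHS](ACl (1*2*5*3*6*4*7)).
Qed.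

Lemma uD_mul a b : uD (a ** b) = uD a ** b + a ** uD b + lam *: (uD a ** uD b).
Proof.
apply: (@lin_eq _ _ _ (fun a => uD (a ** b))
    (fun a => uD a ** b + a ** uD b + lam *: (uD a ** uD b)));
  [by lin_tac | by lin_tac |] => u.
apply: (@lin_eq _ _ _ (fun b => uD (delta u ** b))
    (fun b => uD (delta u) ** b + delta u ** uD b + lam *: (uD (delta u) ** uD b)));
  [by lin_tac | by lin_tac |] => v.
by rewrite fmul_e !uD_e dmon_cat.
Qed.

(** * Factorisation of words and the antiderivative *)

Fixpoint dec l : option (seq (pgen X) * pgen X) :=
  match l with
  | [::] => None
  | inl y :: l' => Some ([::], Qx y l')
  | inr q :: l' => if dec l' is Some (m, q') then Some (q :: m, q') else Some ([::], Qp q)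
  end.

(** Together with [decP] this is the unique factorisation of a nonempty word as a word in the
    letters [q] followed by some [wl q]. *)
Lemma dec_wl m q : dec (pword_of m ++ wl q) = Some (m, q).
Proof. by elim: m => [|p m /= ->] //; case: q. Qed.

Lemma decP l : l <> [::] -> exists m q, l = pword_of m ++ wl q.
Proof.
elim: l => [//|[y|q] l IH] _; first by exists [::], (Qx y l).
case: l IH => [_|h l /(_ _)[//|m [p ->]]]; first by exists [::], (Qp q).
by exists (q :: m), p.
Qed.

(** The termination measure for the antiderivative: the weight of the prefix in the factorisation.
    The default 0 is taken only at the empty word. *)
Definition mu l : nat := if dec l is Some (m, _) then wt (pword_of m) else 0%N.

Lemma mu_wl m q : mu (pword_of m ++ wl q) = wt (pword_of m).
Proof. by rewrite /mu dec_wl. Qed.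

Lemma mu_cat v t : mu t = 0%N -> (mu (v ++ t) <= wt v)%N.
Proof.
move=> mt; elim: v => [|[y|q] v IH] //=; first by rewrite mt.
move: IH; rewrite /mu /=; case: (dec _) => [[m p]|] //=.
by rewrite /wt /= leq_add2l.
Qed.

(** Every term of the derivative replaces at least one letter [q] by [wl q], each replacement
    costing one unit of weight. *)
Lemma dmon_pword_span m :
  bspan (fun v => (wt v < wt (pword_of m))%N) (dmon (pword_of m)).
Proof.
elim: m => [|q m IH]; first exact: lspan0.
have Ewt v : wt (inr q :: v) = (qwt q + wt v)%N by [].
have Sq : bspan (fun v => (wt v < qwt q)%N) (dgen (inr q)).
  by apply: bspan_e; rewrite qwt_wl.
rewrite [dmon _]/= [pword_of _]/= -/(pword_of m); apply: lspanD; first apply: lspanD; last apply: lspanZ.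
- apply: (bspan_fmul (R2 := fun v => v = pword_of m) _ Sq); last exact: bspan_e.
  by move=> t u Ht ->; rewrite wt_cat Ewt; lia.
- apply: (bspan_fmul (R1 := fun v => v = [:: inr q]) _ _ IH); last exact: bspan_e.
  by move=> t u -> Hu; rewrite wt_cat !Ewt; rewrite /wt /= in Hu *; lia.
- by apply: (bspan_fmul _ Sq IH) => t u Ht Hu; rewrite wt_cat Ewt; lia.
Qed.

(** With [t] equal to [[:: inr q]] or [wl q], these are the arguments of the recursive calls in
    [Pfuel]: nonempty words of smaller [mu]. *)
Lemma mu_span m t : t <> [::] -> mu t = 0%N ->
  bspan (fun v => v <> [::] /\ (mu v < wt (pword_of m))%N) (dmon (pword_of m) ** delta t).
Proof.
move=> tn mt; apply: (bspan_fmul (R2 := fun v => v = t) _ (dmon_pword_span m)).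
  move=> v _ Hv ->; split; first by case: v {Hv} => //=.
  by apply: leq_ltn_trans Hv; apply: mu_cat.
exact: bspan_e.
Qed.

Lemma wl_nil q : wl q <> [::]. Proof. by case: q. Qed.
Lemma wl_mu q : mu (wl q) = 0%N. Proof. exact: (mu_wl [::]). Qed.

(* [Pfuel n l] is the antiderivative of [l] once [n] exceeds [mu l], and junk before that. *)
Fixpoint Pfuel n l : U :=
  if n is n'.+1 then
    if dec l is Some (m, q) then
      delta (pword_of (rcons m q)) - ext (Pfuel n') (dmon (pword_of m) ** delta [:: inr q])
        - lam *: ext (Pfuel n') (dmon (pword_of m) ** delta (wl q))
    else 0
  else 0.

Lemma Pfuel_stable n n' l : (mu l < n)%N -> (mu l < n')%N -> Pfuel n l = Pfuel n' l.
Proof.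
elim: n n' l => [//|n IH] [//|n'] l /=; rewrite /mu; case E: (dec l) => [[m q]|] // Hn Hn'.
have eqf t : t <> [::] -> mu t = 0%N ->
    ext (Pfuel n) (dmon (pword_of m) ** delta t) = ext (Pfuel n') (dmon (pword_of m) ** delta t).
  move=> tn mt; apply: (bspan_eq (@lin_ext _ _ _ _) (@lin_ext _ _ _ _) _ (mu_span m tn mt)).
  by move=> v [_ Hv]; rewrite !ext_e; apply: IH; lia.
by rewrite !eqf // ?wl_mu //; apply: wl_nil.
Qed.

Definition uP : U -> U := ext (fun l => Pfuel (mu l).+1 l).

Lemma lin_uP : lin uP. Proof. exact: lin_ext. Qed.

(** The recursion of [Pfuel] freed of its fuel: the recursive arguments have smaller [mu], where
    [Pfuel] no longer depends on the fuel. *)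
Lemma uP_wl m q : uP (delta (pword_of m ++ wl q)) =
  delta (pword_of (rcons m q)) - uP (dmon (pword_of m) ** delta [:: inr q])
    - lam *: uP (dmon (pword_of m) ** delta (wl q)).
Proof.
rewrite {1}/uP ext_e /= dec_wl mu_wl.
have eqf t : t <> [::] -> mu t = 0%N ->
    ext (Pfuel (wt (pword_of m))) (dmon (pword_of m) ** delta t) = uP (dmon (pword_of m) ** delta t).
  move=> tn mt; apply: (bspan_eq (@lin_ext _ _ _ _) lin_uP _ (mu_span m tn mt)).
  by move=> v [_ Hv]; rewrite /uP !ext_e; apply: Pfuel_stable.
by rewrite !eqf // ?wl_mu //; apply: wl_nil.
Qed.

(** [aug] is the augmentation ideal, the nonunital algebra that carries the structure. [consts] is
    the subalgebra C of the construction, on which [uP] inverts [uD]. *)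
Definition aug := bspan (K := K) (fun l => l <> [::]).
Definition consts := bspan (K := K) (fun l => exists m q, l = pword_of (rcons m q)).

Lemma dmon_rcons m q : dmon (pword_of (rcons m q)) =
  dmon (pword_of m) ** delta [:: inr q] + delta (pword_of m ++ wl q) +
  lam *: (dmon (pword_of m) ** delta (wl q)).
Proof.
rewrite /pword_of map_rcons -cats1 dmon_cat /= !fmul0r !scaler0 !addr0.
by rewrite !(fmul_e, cats0).
Qed.

(* The recursion for [uP] is the Leibniz rule for [D (m q)] solved for [m (wl q)]. *)
Lemma uPD c : consts c -> uP (uD c) = c.
Proof.
apply: (bspan_eq (f := fun c => uP (uD c)) (g := id)); [by lin_tac | by lin_tac |].
move=> _ [m [q ->]]; rewrite uD_e dmon_rcons !(linD lin_uP) (linZ lin_uP) uP_wl.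
by rewrite -addrA subrK addrC subrK.
Qed.

(** Induction on [mu]. In [uP_wl], [uD] turns the two subtracted antiderivatives back into the lower
    terms of D(m q), and these cancel, leaving m followed by [wl q]. *)
Lemma uP_props l : l <> [::] -> uD (uP (delta l)) = delta l /\ consts (uP (delta l)).
Proof.
have [n] := ubnP (mu l); elim: n l => // n IH l Hn /decP[m [q E]].
move: Hn; rewrite {}E mu_wl ltnS => Hn.
have key t : t <> [::] -> mu t = 0%N ->
    uD (uP (dmon (pword_of m) ** delta t)) = dmon (pword_of m) ** delta t /\
    consts (uP (dmon (pword_of m) ** delta t)).
  move=> tn mt; split.
    apply: (bspan_eq (f := fun c => uD (uP c)) (g := id) _ _ _ (mu_span m tn mt));
      [by lin_tac| by lin_tac|].
    by move=> v [vn Hv]; case: (IH v) => //; lia.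
  apply: (bspan_lin lin_uP _ (mu_span m tn mt)) => v [vn Hv].
  by case: (IH v) => //; lia.
have [//|//|D1 C1] := key [:: inr q]; have [D2 C2] := key _ (@wl_nil q) (wl_mu q).
rewrite uP_wl; split; last first.
  by apply: lspanB; [apply: lspanB => //; apply: bspan_e; exists m, q|apply: lspanZ].
rewrite !(linD lin_uD, linN lin_uD, linZ lin_uD) uD_e dmon_rcons D1 D2.
by rewrite addrAC addrK addrAC subrr add0r.
Qed.

Lemma uDP a : aug a -> uD (uP a) = a.
Proof.
apply: (bspan_eq (f := fun c => uD (uP c)) (g := id)); [by lin_tac | by lin_tac |].
by move=> l /uP_props[].
Qed.

Lemma uP_consts a : aug a -> consts (uP a).
Proof. by apply: (bspan_lin lin_uP) => l /uP_props[]. Qed.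

Lemma consts_mul a b : consts a -> consts b -> consts (a ** b).
Proof.
apply: bspan_fmul => _ _ [m [q ->]] [m' [q' ->]]; exists (rcons m q ++ m'), q'.
by rewrite rcons_cat /pword_of map_cat.
Qed.

Lemma consts_aug a : consts a -> aug a.
Proof. by apply: lspan_sub => _ [_ [m [q ->]] ->]; apply: bspan_e; case: m. Qed.

Lemma aug_mul a b : aug a -> aug b -> aug (a ** b).
Proof. by apply: bspan_fmul => -[]. Qed.

Lemma uP_mul a b : aug a -> aug b ->
  uP a ** uP b = uP (a ** uP b) + uP (uP a ** b) + lam *: uP (a ** b).
Proof.
move=> ha hb; rewrite -[LHS]uPD; last by apply: consts_mul; apply: uP_consts.
by rewrite uD_mul !uDP // !(linD lin_uP) (linZ lin_uP).
Qed.

End Model.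
Arguments uP {K} lam {X}. Arguments uD {K} lam {X}.

(** * Recovering normal words from their values *)

Section NormalFormMap.
Variables (K : comPzRingType) (lam : K) (X : Type).
Implicit Types (q : pgen X) (m : seq (pgen X)) (l r t u v : seq (gen X)).

Local Notation U := (fmod K (seq (gen X))).
Local Notation V := (fmod K (seq (letter X))).
Local Notation "a ** b" := (fmul cat a b) (at level 40, left associativity).

Definition xhead l : Prop := if l is inr _ :: _ then False else True.

Fixpoint psplit l : seq (pgen X) * seq (gen X) :=
  if l is inr q :: l' then let: (m, r) := psplit l' in (q :: m, r) else ([::], l).

Lemma psplitP l : let: (m, r) := psplit l in l = pword_of m ++ r /\ xhead r.
Proof. by elim: l => [|[y|q] l] //=; case: (psplit l) => m r [-> ?]. Qed.

Lemma psplit_cat m r : xhead r -> psplit (pword_of m ++ r) = (m, r).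
Proof. by move=> xr; elim: m => [|q m /= ->] //; case: r xr => [|[]]. Qed.

(** [V] is spanned by all lists of letters, the empty one serving as unit. P of the empty list is
    not a letter, so 0 is a filler there. *)
Definition fP : V -> V := ext (fun s => if s is a :: s' then delta K [:: LP a s'] else 0).

(** A letter x_i is read as D^i x. A maximal block c of letters [q] equals P(D c), so it is read as
    P of the image of [dmon c]; this derivative has smaller weight, which the fuel bounds. *)
Fixpoint gfuel n l : V :=
  if n is n'.+1 then
    match l with
    | [::] => delta K [::]
    | inl y :: l' => delta K [:: Dpow y.1 y.2] ** gfuel n' l'
    | inr q :: l' => let: (m, r) := psplit l' in
        fP (ext (gfuel n') (dmon lam (pword_of (q :: m)))) ** gfuel n' r
    end
  else 0.

Lemma gfuel_stable n n' l : (wt l < n)%N -> (wt l < n')%N -> gfuel n l = gfuel n' l.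
Proof.
elim: n n' l => [//|n IH] [//|n'] [|[y|q] l] //=.
  by move=> Hn Hn'; congr (_ ** _); apply: IH; rewrite /wt /= in Hn Hn' *; lia.
have := psplitP l; case: (psplit l) => m r [-> _]; rewrite -cat_cons.
rewrite -[inr q :: pword_of m]/(pword_of (q :: m)) !wt_cat => Hn Hn'.
have Hq : (0 < wt (pword_of (q :: m)))%N by rewrite /wt /= qwt_wl.
congr (fP _ ** _); last by apply: IH; lia.
apply: (bspan_eq (@lin_ext _ _ _ _) (@lin_ext _ _ _ _) _ (dmon_pword_span lam (q :: m))).
by move=> v Hv; rewrite !ext_e; apply: IH; lia.
Qed.

Definition gam : U -> V := ext (fun l => gfuel (wt l).+1 l).

Lemma lin_gam : lin gam. Proof. exact: lin_ext. Qed.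

Lemma gam_e n l : (wt l < n)%N -> gam (delta K l) = gfuel n l.
Proof. by move=> Hn; rewrite /gam ext_e; apply: gfuel_stable. Qed.

Lemma gam_nil : gam (delta K [::]) = delta K [::].
Proof. by rewrite /gam ext_e. Qed.

Lemma gam_xmul y a : gam (delta K [:: inl y] ** a) = delta K [:: Dpow y.1 y.2] ** gam a.
Proof.
apply: (@lin_eq _ _ _ (fun a => gam (delta K [:: inl y] ** a))
  (fun a => delta K [:: Dpow y.1 y.2] ** gam a)); [by lin_tac | by lin_tac | move=> l].
rewrite fmul_e (@gam_e (wt l).+2) // (gam_e (leqnn (wt l).+1)) //.
Qed.

Lemma gam_pmul m q r : xhead r ->
  gam (delta K (pword_of (rcons m q)) ** delta K r) =
  fP (gam (uD lam (delta K (pword_of (rcons m q))))) ** gam (delta K r).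
Proof.
move=> xr; rewrite fmul_e uD_e.
have [q' [m' ->]] : exists q' m', rcons m q = q' :: m'.
  by case: m => [|q' m']; [exists q, [::] | exists q', (rcons m' q)].
have Hq : (0 < wt (pword_of (q' :: m')))%N by rewrite /wt /= qwt_wl.
rewrite (@gam_e (wt (pword_of (q' :: m') ++ r)).+1) //= psplit_cat //.
congr (fP _ ** _); last first.
  rewrite (gam_e (leqnn _)); apply: gfuel_stable; rewrite -?cat_cons ?wt_cat //.
  by rewrite /wt /= in Hq *; lia.
apply: (bspan_eq (@lin_ext _ _ _ _) lin_gam _ (dmon_pword_span lam (q' :: m'))).
move=> v Hv; rewrite ext_e /= (gam_e (leqnn _)); apply: gfuel_stable => //.
by rewrite -cat_cons wt_cat -[inr q' :: _]/(pword_of (q' :: m')); lia.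
Qed.

(** [uP a] is a combination of blocks of letters [q]. No word of [b] begins with such a letter, so
    these blocks stay maximal in the product, and each is read as P of its derivative; the
    derivative of [uP a] is [a]. *)
Lemma gam_uP a b : aug a -> bspan xhead b -> gam (uP lam a ** b) = fP (gam a) ** gam b.
Proof.
move=> ha; rewrite -{2}(uDP lam ha); move: (uP_consts lam ha); move: (uP lam a) => c hc hb.
apply: (bspan_eq (f := fun c => gam (c ** b))
  (g := fun c => fP (gam (uD lam c)) ** gam b) _ _ _ hc); [by lin_tac | by lin_tac |].
move=> _ [m [q ->]].
apply: (bspan_eq (f := fun b => gam (_ ** b)) (g := fun b => fP _ ** gam b) _ _ _ hb).
- by lin_tac.
- by lin_tac.
exact: gam_pmul.
Qed.

End NormalFormMap.
Arguments gam {K} lam {X}.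

(** * Evaluation of words and normal words *)

(** The generated induction principle gives no hypothesis for the letters in the list under P or D;
    this one does. *)
Lemma letter_nested_ind (X : Type) (R : letter X -> Prop) :
  (forall x, R (Lx x)) ->
  (forall a l, R a -> List.Forall R l -> R (LP a l)) ->
  (forall a l, R a -> List.Forall R l -> R (LD a l)) ->
  forall a, R a.
Proof.
move=> Hx HP HD; fix IH 1 => -[x|a l|a l]; first exact: Hx.
  by apply: HP; [exact: IH | elim: l => [|b l Hl]; constructor].
by apply: HD; [exact: IH | elim: l => [|b l Hl]; constructor].
Qed.

Section Evaluation.
Variables (K : comPzRingType) (lam : K) (X : Type) (A : lmodType K).
Variables (mul : A -> A -> A) (P D : A -> A) (f : X -> A).
Hypotheses (mulA : forall x y z, mul x (mul y z) = mul (mul x y) z).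
Hypotheses (lin_mull : forall z, lin (fun x => mul x z)) (lin_mulr : forall z, lin (mul z)).
Hypotheses (lin_P : lin P) (lin_D : lin D).

(** The target algebra need not have a unit, so a product always has a first factor. *)
Fixpoint prodne (a : A) (s : seq A) : A := if s is b :: s' then mul a (prodne b s') else a.

Fixpoint evL (a : letter X) : A :=
  match a with
  | Lx x => f x
  | LP a l => P (prodne (evL a) (map evL l))
  | LD a l => D (prodne (evL a) (map evL l))
  end.

Definition evw (w : word X) : A := prodne (evL w.1) (map evL w.2).

Lemma evw_cat u v : evw (wcat u v) = mul (evw u) (evw v).
Proof.
rewrite /evw /=; case: u => a l /=; elim: l a => [|b l IH] a //=.
by rewrite IH mulA.
Qed.

Lemma evw_unique (psi : word X -> A) :
  (forall u v, psi (wcat u v) = mul (psi u) (psi v)) ->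
  (forall u, psi (wP u) = P (psi u)) -> (forall u, psi (wD u) = D (psi u)) ->
  (forall x, psi (wx x) = f x) -> forall w, psi w = evw w.
Proof.
move=> psiM psiP psiD psix.
have step a l : psi (a, [::]) = evL a -> List.Forall (fun b => psi (b, [::]) = evL b) l ->
    psi (a, l) = evw (a, l).
  elim: l a => [//|b l IH] a Ha Hl; inversion_clear Hl.
  by rewrite -[(a, _)]/(wcat (a, [::]) (b, l)) psiM IH // Ha.
have Hlet a : psi (a, [::]) = evL a.
  elim/letter_nested_ind: a => [x|a l Ha Hl|a l Ha Hl]; first exact: psix.
    by rewrite -[(_, _)]/(wP (a, l)) psiP step.
  by rewrite -[(_, _)]/(wD (a, l)) psiD step.
by move=> [a l]; apply: step => //; elim: l => [|b l IH]; constructor.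
Qed.

Variable phi : word X -> A.
Hypotheses (phiM : forall u v, phi (wcat u v) = mul (phi u) (phi v)).
Hypotheses (phiP : forall u, phi (wP u) = P (phi u)) (phiD : forall u, phi (wD u) = D (phi u)).

Lemma phi_lmulw l : exists2 L : A -> A, lin L & forall w, phi (lmulw l w) = L (phi w).
Proof.
case: l => [|a l]; first by exists id.
by exists (mul (phi (a, l))) => // w; rewrite -phiM.
Qed.

Lemma phi_rmulw r : exists2 L : A -> A, lin L & forall w, phi (rmulw w r) = L (phi w).
Proof.
case: r => [|a r]; first by exists id => // -[b l]; rewrite /rmulw cats0.
by exists (fun x => mul x (phi (a, r))) => // w; rewrite -phiM.
Qed.

(** When [phi] respects products, P and D, filling a context acts on values as a linear operator, so
    a relation that evaluates to 0 does so in every context. *)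
Lemma phi_csubw c : exists2 L : A -> A, lin L & forall w, phi (csubw c w) = L (phi w).
Proof.
have both l r : exists2 L : A -> A, lin L & forall w, phi (lmulw l (rmulw w r)) = L (phi w).
  have [L1 l1 E1] := phi_lmulw l; have [L2 l2 E2] := phi_rmulw r.
  by exists (fun x => L1 (L2 x)) => [|w]; [apply: lin_comp|rewrite E1 E2].
elim: c => [l r|l r c [L lL EL]|l r c [L lL EL]] /=; have [L1 l1 E1] := both l r.
- by exists L1.
- exists (fun x => L1 (P (L x))) => [|w]; last by rewrite E1 phiP EL.
  by apply: lin_comp => //; apply: lin_comp.
- exists (fun x => L1 (D (L x))) => [|w]; last by rewrite E1 phiD EL.
  by apply: lin_comp => //; apply: lin_comp.
Qed.

Lemma pext_Id : (forall s, inS lam s -> pext phi s = 0) ->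
  forall p, inId lam p -> pext phi p = 0.
Proof.
move=> HS p [g [Hg Hp]]; rewrite [LHS](gext_ext phi Hp) {p Hp}.
elim: g Hg => [|[[k c] s] g IH] Hg /=; first by rewrite /gext big_nil.
rewrite gext_cat gext_scale [X in _ + X]IH => [|t gt]; last by apply: Hg; right.
have [L lL EL] := phi_csubw c.
have -> : gext phi (psubst c s) = L (pext phi s).
  rewrite /gext big_map (lin_sum lL); apply: eq_bigr => a _ /=.
  by rewrite EL linZ.
rewrite HS ?(lin0 lL) ?scaler0 ?addr0 //.
by apply: (Hg (k, c, s)); left.
Qed.

(** The identities are asked only at values of [phi]: in the model, the Rota-Baxter identity and D P
    = id are established on [aug], where all values lie. *)
Lemma pext_inS :
  (forall x y, mul (P (phi x)) (P (phi y)) =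
    P (mul (phi x) (P (phi y))) + P (mul (P (phi x)) (phi y)) + lam *: P (mul (phi x) (phi y))) ->
  (forall x y, D (mul (phi x) (phi y)) =
    mul (D (phi x)) (phi y) + mul (phi x) (D (phi y)) + lam *: mul (D (phi x)) (D (phi y))) ->
  (forall x, D (P (phi x)) = phi x) ->
  forall s, inS lam s -> pext phi s = 0.
Proof.
move=> HRB HD HDP _ [x [y [->|[->|->]]]]; rewrite /pext !big_cons big_nil /=.
- rewrite !(phiP, phiM) HRB !scale1r !scaleNr !scale1r addr0 -!opprD !addrA; exact: subrr.
- rewrite !(phiD, phiM) HD !scale1r !scaleNr !scale1r addr0 -!opprD !addrA; exact: subrr.
- by rewrite phiD phiP HDP scaleN1r scale1r addr0 subrr.
Qed.

End Evaluation.

(** * An inductive description of the words of Phi *)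

Section NormalForms.
Variable X : Type.
Implicit Types (a b : letter X) (l r : seq (letter X)) (w z : word X).

Definition isP a : bool := if a is LP _ _ then true else false.
Definition startsP l : bool := if l is a :: _ then isP a else false.
Definition endsP l : bool := if l is a :: l' then isP (last a l') else false.

Inductive NF : seq (letter X) -> Prop :=
  | NF0 : NF [::]
  | NFD i x l : NF l -> NF (Dpow i x :: l)
  | NFP a l' l : NF (a :: l') -> ~~ startsP l -> NF l -> NF (LP a l' :: l).

Lemma isP_Dpow i (x : X) : isP (Dpow i x) = false. Proof. by case: i. Qed.

Lemma NF_Phi0 y l : Phi0 y -> NF l -> NF (wletters y ++ l).
Proof.
rewrite /Phi0; move: (wletters y) => t H nl.
elim: t H => [|b t IH] H /=; first exact: nl.
have [|i [x ->]] := H b; first by left.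
by apply: NFD; apply: IH => c cs; apply: H; right.
Qed.

Lemma startsP_Phi0 y l : Phi0 y -> startsP (wletters y ++ l) = false.
Proof. by case: y => a s H; have [|i [x /= ->]] := H a; [left|rewrite isP_Dpow]. Qed.

Lemma Phin_NF n w : Phin n w -> NF (wletters w).
Proof.
elim: n w => [|n IH] w /=; first by move=> H; rewrite -[wletters w]cats0; apply: NF_Phi0 H NF0.
move=> [bs [_ [alt [Hbs <-]]]]; elim: bs alt Hbs => [|b bs IHb] alt Hbs; first exact: NF0.
have nbs : NF (flatten (map (@blk_letters X) bs)).
  by apply: IHb => [|c cs]; [by case: bs alt {Hbs} => // c bs /= /andP[] | apply: Hbs; right].
have := Hbs b (or_introl erefl); case: b alt Hbs => [y|z] alt Hbs Hb /=; first exact: NF_Phi0.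
apply: NFP => //; first exact: (IH z).
(* By alternation, the block after P(z) is a word of [Phi0], whose first letter is not a P. *)
case: bs alt Hbs {IHb nbs} => [|[y|z'] bs] // _ Hbs.
by apply/negbT/startsP_Phi0; apply: (Hbs (BY y)); right; left.
Qed.

Lemma Phin_mono n w : Phin n w -> Phin n.+1 w.
Proof.
elim: n w => [|n IH] w /=.
  move=> H; exists [:: BY w]; do !split => //=; last by rewrite cats0.
  by move=> b [<-|].
move=> [bs [bn [alt [Hbs E]]]]; exists bs; do !split => //.
by move=> b /Hbs; case: b => // z; apply: IH.
Qed.

Lemma Phin_le n m w : (n <= m)%N -> Phin n w -> Phin m w.
Proof.
elim: m => [|m IH]; first by case: n.
by rewrite leq_eqVlt => /orP[/eqP-> //|/IH H /H]; apply: Phin_mono.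
Qed.

(** Blocks are built from the right end: D^i x joins a leading [BY] block or opens one, and a P
    letter opens a [BPz] block. The clause on [startsP] turns the side condition of [NFP] into
    alternation; differing levels are merged by a maximum, as [Phin] is cumulative. *)
Lemma NF_blocks l : NF l -> exists n (bs : seq (blk X)), [/\ alternating bs,
  forall b : blk X, List.In b bs -> match b with BY y => Phi0 y | BPz z => Phin n z end,
  flatten (map (@blk_letters X) bs) = l & startsP l = if bs is BPz _ :: _ then true else false].
Proof.
elim=> {l} [|i x l _ [n [bs [alt Hbs E Hh]]]|
  a l' l _ [n1 [bs1 [alt1 H1 E1 _]]] hl _ [n2 [bs2 [alt2 H2 E2 h2]]]].
- by exists 0%N, [::].
- have HD c : List.In c [:: Dpow i x] -> exists j y, c = Dpow j y by case=> // <-; exists i, x.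
  case: bs alt Hbs E Hh => [|[y|z] bs] alt Hbs E Hh.
  + exists n, [:: BY (Dpow i x, [::])]; split=> //=; last by rewrite isP_Dpow.
      by move=> b [<-|//].
    by rewrite -E.
  + exists n, (BY (Dpow i x, wletters y) :: bs); split=> //=; last by rewrite isP_Dpow.
      move=> b [<-|bb]; last by apply: Hbs; right.
      move=> c /= [<-|cy]; first by exists i, x.
      by apply: (Hbs (BY y)) => //; left.
    by rewrite -E.
  + exists n, (BY (Dpow i x, [::]) :: BPz z :: bs); split=> //=; last by rewrite isP_Dpow.
      move=> b [<-|bb]; last exact: Hbs.
      exact: HD.
    by rewrite -E.
exists (maxn n1.+1 n2), (BPz (a, l') :: bs2); split=> //=.
- by case: bs2 alt2 h2 hl {H2 E2} => [|[y|z] bs] // _ ->.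
- move=> b [<-|/H2].
    apply: (@Phin_le n1.+1); first exact: leq_maxl.
    exists bs1; do !split => //; by case: bs1 E1 {alt1 H1}.
  case: b => // z; apply: Phin_le; exact: leq_maxr.
- by rewrite E2.
Qed.

Lemma NF_Phi w : NF (wletters w) <-> Phi w.
Proof.
split=> [/NF_blocks[n [bs [alt H E _]]]|[n]]; last exact: Phin_NF.
by exists n.+1, bs; do !split => //; case: bs E {alt H}.
Qed.

End NormalForms.

(** * Linear independence of Phi modulo the ideal *)

Section Independence.
Variables (K : comPzRingType) (lam : K) (X : Type).
Local Notation U := (fmod K (seq (gen X))).
Local Notation "a ** b" := (fmul cat a b) (at level 40, left associativity).

Definition ugen (x : X) : U := delta K [:: inl (0%N, x)].
Definition uL : letter X -> U := evL (fmul cat) (uP lam) (uD lam) ugen.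
Definition uw : word X -> U := evw (fmul cat) (uP lam) (uD lam) ugen.
Definition us (l : seq (letter X)) : U := foldr (fun a x => uL a ** x) (delta K [::]) l.

Lemma us_word w : uw w = us (wletters w).
Proof.
case: w => a l; rewrite /uw /evw /= -/uL; elim: l a => [|b l IH] a /=; first by rewrite umulr1.
by rewrite IH.
Qed.

Lemma uD_aug (a : U) : aug a -> aug (uD lam a).
Proof.
apply: (bspan_lin (@lin_uD _ _ _)) => -[//|g l] _; rewrite uD_e /=.
have ag : aug (dgen K g) by case: g => [y|q]; apply: bspan_e => //; apply: wl_nil.
have all_ (b : U) : bspan (fun=> True) b by apply: bspan_all.
apply: lspanD; first apply: lspanD; last apply: lspanZ.
- by apply: (bspan_fmul _ ag (all_ _)) => -[].
- have eg : aug (delta K [:: g]) by apply: bspan_e.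
  by apply: (bspan_fmul _ eg (all_ _)) => -[].
- by apply: (bspan_fmul _ ag (all_ _)) => -[].
Qed.

Lemma uw_aug w : aug (uw w).
Proof.
have step a l : aug (uL a) -> List.Forall (fun b => aug (uL b)) l -> aug (uw (a, l)).
  elim: l a => [//|b l IH] a Ha Hl; inversion_clear Hl.
  by apply: aug_mul => //; apply: IH.
have Hlet a : aug (uL a).
  elim/letter_nested_ind: a => [x|a l Ha Hl|a l Ha Hl]; first exact: bspan_e.
    by apply: consts_aug; apply: uP_consts; apply: (step a l).
  by apply: uD_aug; apply: (step a l).
by case: w => a l; apply: step => //; elim: l => [|b l IH]; constructor.
Qed.

Lemma uL_Dpow i x : uL (Dpow i x) = delta K [:: inl (i, x)].
Proof.
elim: i => [//|i IH]; rewrite -[LHS]/(uD lam (uL (Dpow i x))) IH uD_e /=.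
by rewrite !fmul0r scaler0 !addr0 fmul_e.
Qed.

(** Induction on the normal list. The second conjunct supplies the head condition of [gam_uP] for
    the tail behind a P letter. *)
Lemma gam_NF l : NF l -> gam lam (us l) = delta K l /\ (~~ startsP l -> bspan (@xhead X) (us l)).
Proof.
elim=> {l} [|i x l _ [IH _]|a l' l _ [IH1 _] hl _ [IH2 /(_ hl) xl]].
- by rewrite /= gam_nil; split=> // _; apply: bspan_e.
- rewrite -[us _]/(uL (Dpow i x) ** us l) uL_Dpow gam_xmul IH fmul_e; split=> // _.
  apply: (bspan_fmul (R1 := fun u => u = [:: inl (i, x)]) (R2 := fun=> True)).
  + by move=> _ v ->.
  + exact: bspan_e.
  + exact: bspan_all.
rewrite -[us (_ :: l)]/(uP lam (uw (a, l')) ** us l) gam_uP //; last exact: uw_aug.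
by rewrite us_word IH1 IH2 /fP ext_e fmul_e.
Qed.

Lemma uw_inId p : inId lam p -> pext uw p = 0.
Proof.
have uwM u v : uw (wcat u v) = uw u ** uw v by apply: evw_cat; apply: umulA.
apply: (pext_Id (mul := fmul cat) (P := uP lam) (D := uD lam)) => //.
- exact: lin_fmull.
- exact: lin_fmulr.
- exact: lin_uP.
- exact: lin_uD.
apply: (pext_inS (mul := fmul cat) (P := uP lam) (D := uD lam)) => //.
- by move=> x y; apply: uP_mul; apply: uw_aug.
- by move=> x y; apply: uD_mul.
- by move=> x; apply: uDP; apply: uw_aug.
Qed.

(** The value of [q] in the model is 0. Applying [gam] turns it back into the same combination of
    distinct basis lists, so all coefficients vanish. *)
Lemma Phi_independent (q : opoly K X) : (forall a, List.In a q -> Phi a.2) ->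
  inId lam q -> forall w, coef q w = 0.
Proof.
move=> Hq /uw_inId Eq w.
have Eg : \sum_(a <- q) a.1 *: delta K (wletters a.2) = 0 :> fmod K (seq (letter X)).
  transitivity (gam lam (pext uw q)); last by rewrite Eq (lin0 (@lin_gam _ _ _)).
  rewrite /pext (lin_sum (@lin_gam _ _ _)).
  elim: q Hq {Eq} => [|a q IH] Hq; first by rewrite !big_nil.
  rewrite !big_cons IH => [|b bq]; last by apply: Hq; right.
  rewrite (linZ (@lin_gam _ _ _)) us_word; congr (_ *: _ + _).
  by have [|-> _] := @gam_NF (wletters a.2) => //; apply/NF_Phi; apply: Hq; left.
have := congr1 (fun v : fmod K (seq (letter X)) => v (wletters w)) Eg.
rewrite (lin_sum (@lin_fcoef K _ _)) (lin0 (@lin_fcoef K _ _)) => <-.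
apply: eq_bigr => a _; rewrite (linZ (@lin_fcoef K _ _)) e_coef.
have -> : eqT (wletters a.2) (wletters w) = weqb a.2 w.
  apply/eqTP/(eqTP a.2 w) => [|-> //].
  by case: a.2 w => [b s] [b' s'] [-> ->].
by case: ifP => _; [rewrite /GRing.scale /= mulr1 | rewrite scaler0].
Qed.

End Independence.

(** * Normal words span modulo the ideal *)

Lemma In_cat (T : Type) (a : T) s t : List.In a (s ++ t) -> List.In a s \/ List.In a t.
Proof. by elim: s => [|b s IH] /=; [right|case=> [->|/IH[]]; auto]. Qed.

Lemma In_map (T T' : Type) (f : T -> T') s b :
  List.In b (map f s) -> exists2 a, List.In a s & b = f a.
Proof.
elim: s => [//|a s IH] /= [<-|/IH[a' sa' ->]]; first by exists a => //; left.
by exists a' => //; right.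
Qed.

Section MoreNormalForms.
Variable X : Type.
Implicit Types (a b : letter X) (l r : seq (letter X)).

Lemma endsP_cons a l : l <> [::] -> endsP (a :: l) = endsP l.
Proof. by case: l. Qed.

Lemma NF_cat l r : NF l -> NF r -> ~~ (endsP l && startsP r) -> NF (l ++ r).
Proof.
elim=> {l} [//|i x l _ IH|a l' l Ha _ hl _ IH] Hr H /=.
  apply: NFD; apply: IH => //.
  by case: l H => // b l.
case: l hl H IH => [|b l] hl H IH; apply: NFP => //; first exact: IH.
Qed.

Lemma NF_catl l r : NF (l ++ r) -> NF l.
Proof.
move E: (l ++ r) => s Hs; elim: Hs l E => {s} [|i x s _ IH|a s' s Ha _ hs _ IH] [|b l] //=;
  try by constructor.
  by move=> [-> /IH]; apply: NFD.
move=> [-> E]; apply: NFP => //; last exact: IH.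
by rewrite -{}E in hs; case: l hs.
Qed.

Lemma NF_behead a l : NF (a :: l) -> NF l.
Proof. by move=> H; inversion_clear H. Qed.

Lemma NF_rconsP l a l' : NF (rcons l (LP a l')) -> NF l /\ ~~ endsP l.
Proof.
move=> H; split; first by move: H; rewrite -cats1; apply: NF_catl.
elim: l H => [//|b l IH] H; case: l IH H => [_|c l IH] H.
  by inversion_clear H; [rewrite /= isP_Dpow|].
by rewrite endsP_cons //; apply: IH; apply: NF_behead H.
Qed.

Lemma NF_in l a r l' : NF (l ++ LP a l' :: r) -> NF (a :: l') /\ ~~ startsP r.
Proof.
elim: l => [|b l IH] /= H; last by apply: IH; apply: NF_behead H.
move E: (LP a l' :: r) H => s Hs.
by case: Hs E => [//|[|i] x s' _ []//|b s' s'' Hb hs _ [-> -> ->]].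
Qed.

(** Counts all generators and operator symbols; the reduction of products is an induction on this
    size. *)
Fixpoint lsize a : nat := match a with
  | Lx _ => 1%N
  | LP a l | LD a l => (lsize a + sumn (map lsize l)).+1
  end.
Definition wsize (w : word X) : nat := sumn (map lsize (wletters w)).

End MoreNormalForms.

Section Spanning.
Variables (K : comPzRingType) (lam : K) (X : Type).
Local Notation V := (fmod K (word X)).
Local Notation "a ** b" := (fmul (@wcat X) a b) (at level 40, left associativity).
Local Notation delta := (@delta K (word X)).
Implicit Types (u v w z : word X) (c : ctx X) (p q : opoly K X).

Definition vP : V -> V := ext (fun w => delta (wP w)).
Definition vD : V -> V := ext (fun w => delta (wD w)).
Definition vsub c : V -> V := ext (fun w => delta (csubw c w)).
(** Id(S) as a submodule of the free module; [idl_inId] recovers the explicit list of substitution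
    instances. *)
Definition idl : V -> Prop :=
  lspan (fun a : V => exists c s, inS lam s /\ a = vsub c (gext delta s)).

Lemma gext_map (B : lmodType K) (h : word X -> B) (f : word X -> word X) p :
  gext h [seq (a.1, f a.2) | a <- p] = gext (fun w => h (f w)) p.
Proof. by rewrite /gext big_map. Qed.

Lemma ext_gext (B : lmodType K) (f : word X -> B) p : ext f (gext delta p) = gext f p.
Proof.
rewrite /gext (lin_sum (@lin_ext _ _ _ _)); apply: eq_bigr => a _.
by rewrite (linZ (@lin_ext _ _ _ _)) ext_e.
Qed.

Lemma gext_pmul p q : gext delta (pmul p q) = gext delta p ** gext delta q.
Proof.
rewrite /gext /pmul big_allpairs_dep (lin_sum (@lin_fmull _ _ _ _)); apply: eq_bigr => a _.
rewrite fmulZl (lin_sum (@lin_fmulr _ _ _ _)) scaler_sumr; apply: eq_bigr => b _ /=.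
by rewrite fmulZr fmul_e scalerA.
Qed.

Lemma gext_pP p : gext delta (pP p) = vP (gext delta p).
Proof. by rewrite /vP ext_gext gext_map. Qed.

Lemma gext_pD p : gext delta (pD p) = vD (gext delta p).
Proof. by rewrite /vD ext_gext gext_map. Qed.

Lemma gext_psubst c p : gext delta (psubst c p) = vsub c (gext delta p).
Proof. by rewrite /vsub ext_gext gext_map. Qed.

Lemma gext_psub p q : gext delta (psub p q) = gext delta p - gext delta q.
Proof. by rewrite /psub gext_cat gext_scale scaleN1r. Qed.

Lemma idl_inId p : idl (gext delta p) -> inId lam p.
Proof.
move=> H; suff [g [Hg E]] : exists g : seq (K * ctx X * opoly K X),
    (forall t, List.In t g -> inS lam t.2) /\
    gext delta p = gext delta (flatten [seq pscale t.1.1 (psubst t.1.2 t.2) | t <- g]).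
  by exists g; split=> // w; rewrite -[LHS]gext_coef E gext_coef.
elim: H => {p} [|v [c [s [Hs ->]]]|u v _ [g [Hg ->]] _ [h [Hh ->]]|k v _ [g [Hg ->]]].
- by exists [::]; split=> //; rewrite /gext big_nil.
- exists [:: (1, c, s)]; split=> [t [<-|] //|].
  by rewrite /= cats0 gext_scale scale1r gext_psubst.
- exists (g ++ h); split; last by rewrite map_cat flatten_cat gext_cat.
  by move=> t Ht; case: (In_cat Ht) => [H|H]; [apply: Hg|apply: Hh].
exists [seq (k * t.1.1, t.1.2, t.2) | t <- g]; split.
  by move=> t Ht; have [t' H ->] := In_map Ht; apply: (Hg t').
elim: g {Hg} => [|t g IH] /=; first by rewrite /gext big_nil scaler0.
by rewrite !gext_cat scalerDr IH !gext_scale scalerA.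
Qed.

Lemma lmulw_cat u l z : wcat u (lmulw l z) = lmulw (wletters u ++ l) z.
Proof. by case: l => [|a l]; rewrite /wcat /lmulw /= ?cats0 // -catA. Qed.

Lemma rmulw_cat l z r u : wcat (lmulw l (rmulw z r)) u = lmulw l (rmulw z (r ++ wletters u)).
Proof. by case: l => [|a l]; rewrite /wcat /lmulw /rmulw /wletters /= -catA //= -catA. Qed.

Lemma csubw_mull u c : exists c', forall w, wcat u (csubw c w) = csubw c' w.
Proof.
case: c => [l r|l r c|l r c].
- by exists (CTop (wletters u ++ l) r) => w; rewrite /= lmulw_cat.
- by exists (CinP (wletters u ++ l) r c) => w; rewrite /= lmulw_cat.
- by exists (CinD (wletters u ++ l) r c) => w; rewrite /= lmulw_cat.
Qed.

Lemma csubw_mulr u c : exists c', forall w, wcat (csubw c w) u = csubw c' w.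
Proof.
case: c => [l r|l r c|l r c].
- by exists (CTop l (r ++ wletters u)) => w; rewrite /= rmulw_cat.
- by exists (CinP l (r ++ wletters u) c) => w; rewrite /= rmulw_cat.
- by exists (CinD l (r ++ wletters u) c) => w; rewrite /= rmulw_cat.
Qed.

(** A linear operator that carries contexts to contexts preserves the ideal. Multiplication by a
    word, P and D are of this kind. *)
Lemma idl_ctx (f : V -> V) : lin f ->
  (forall c, exists c', forall w, f (delta (csubw c w)) = delta (csubw c' w)) ->
  forall a, idl a -> idl (f a).
Proof.
move=> lf H; apply: lspan_lin => // _ [c [s [Hs ->]]]; apply: lspan_gen.
have [c' E] := H c; exists c', s; split=> //; rewrite /vsub !ext_gext /gext (lin_sum lf).
by apply: eq_bigr => a _; rewrite (linZ lf) E.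
Qed.

Lemma idl_mull a b : idl b -> idl (a ** b).
Proof.
move=> Hb; apply: (bspan_lin (R := fun=> True) (lin_fmull _ b)); last exact: bspan_all.
move=> u _; apply: idl_ctx Hb; first exact: lin_fmulr.
by move=> c; have [c' E] := csubw_mull u c; exists c' => w; rewrite fmul_e E.
Qed.

Lemma idl_mulr a b : idl a -> idl (a ** b).
Proof.
move=> Ha; apply: (bspan_lin (R := fun=> True) (lin_fmulr _ a)); last exact: bspan_all.
move=> u _; apply: (idl_ctx (f := fun a => a ** delta u)) Ha; first exact: lin_fmull.
by move=> c; have [c' E] := csubw_mulr u c; exists c' => w; rewrite fmul_e E.
Qed.

Lemma idl_vP a : idl a -> idl (vP a).
Proof.
apply: idl_ctx; first exact: lin_ext.
by move=> c; exists (CinP [::] [::] c) => w; rewrite /vP ext_e.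
Qed.

Lemma idl_vD a : idl a -> idl (vD a).
Proof.
apply: idl_ctx; first exact: lin_ext.
by move=> c; exists (CinD [::] [::] c) => w; rewrite /vD ext_e.
Qed.

Lemma idl_gen c s : inS lam s -> idl (gext (fun w => delta (csubw c w)) s).
Proof. by move=> Hs; apply: lspan_gen; exists c, s; rewrite /vsub ext_gext. Qed.

Lemma lmulw0 w : lmulw [::] (rmulw w [::]) = w.
Proof. by case: w => a l; rewrite /= /rmulw /= cats0. Qed.

Lemma csubw_inP l r w : csubw (CinP l r (CTop [::] [::])) w = lmulw l (rmulw (wP w) r).
Proof. by rewrite -[in RHS](lmulw0 w). Qed.

Lemma rule_sumE (a b c d : V) :
  1 *: a + (-1 *: b + (-1 *: c + (- lam *: d + 0))) = a - (b + c + lam *: d).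
Proof. by rewrite addr0 scale1r !scaleN1r scaleNr -!opprD addrA. Qed.

(** By linearity in [a] and [b] it suffices to take words, where the expression is a generator in
    the trivial context. *)
Lemma idl_rb a b :
  idl (vP a ** vP b - (vP (a ** vP b) + vP (vP a ** b) + lam *: vP (a ** b))).
Proof.
apply: (bspan_lin (R := fun=> True)
  (f := fun a => vP a ** vP b - (vP (a ** vP b) + vP (vP a ** b) + lam *: vP (a ** b)))
  _ _ (bspan_all _ a)) => //.
  by lin_tac.
move=> x _.
apply: (bspan_lin (R := fun=> True)
  (f := fun b => vP (delta x) ** vP b -
    (vP (delta x ** vP b) + vP (vP (delta x) ** b) + lam *: vP (delta x ** b)))
  _ _ (bspan_all _ b)) => //.
  by lin_tac.
move=> y _; rewrite /vP !(ext_e, fmul_e).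
have := @idl_gen (CTop [::] [::]) (rb_poly lam x y).
rewrite /gext !big_cons big_nil rule_sumE ![csubw _ _]lmulw0; apply.
by exists x, y; left.
Qed.

Lemma idl_dl a b :
  idl (vD (a ** b) - (vD a ** b + a ** vD b + lam *: (vD a ** vD b))).
Proof.
apply: (bspan_lin (R := fun=> True)
  (f := fun a => vD (a ** b) - (vD a ** b + a ** vD b + lam *: (vD a ** vD b)))
  _ _ (bspan_all _ a)) => //.
  by lin_tac.
move=> x _.
apply: (bspan_lin (R := fun=> True)
  (f := fun b => vD (delta x ** b) -
    (vD (delta x) ** b + delta x ** vD b + lam *: (vD (delta x) ** vD b)))
  _ _ (bspan_all _ b)) => //.
  by lin_tac.
move=> y _; rewrite /vD !(ext_e, fmul_e).
have := @idl_gen (CTop [::] [::]) (dl_poly lam x y).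
rewrite /gext !big_cons big_nil rule_sumE ![csubw _ _]lmulw0; apply.
by exists x, y; right; left.
Qed.

Lemma idl_dp a : idl (vD (vP a) - a).
Proof.
apply: (bspan_lin (R := fun=> True) (f := fun a => vD (vP a) - a) _ _ (bspan_all _ a)) => //.
  by lin_tac.
move=> x _; rewrite /vD /vP !ext_e.
have := @idl_gen (CTop [::] [::]) (dp_poly K x).
rewrite /gext !big_cons big_nil addr0 scaleN1r scale1r ![csubw _ _]lmulw0; apply.
by exists x, x; right; right.
Qed.

(** Being congruent to a combination of normal words: the ideal is put among the generators of the
    span. *)
Definition nfsp : V -> Prop :=
  lspan (fun a : V => (exists2 w, NF (wletters w) & a = delta w) \/ idl a).

Lemma nfsp_e w : NF (wletters w) -> nfsp (delta w).
Proof. by move=> H; apply: lspan_gen; left; exists w. Qed.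

Lemma nfsp_idl a b : nfsp b -> idl (a - b) -> nfsp a.
Proof. by move=> Hb Hab; rewrite -[a](subrK b); apply: lspanD => //; apply: lspan_gen; right. Qed.

Lemma nfsp_lin (f : V -> V) : lin f -> (forall w, NF (wletters w) -> nfsp (f (delta w))) ->
  (forall a, idl a -> idl (f a)) -> forall a, nfsp a -> nfsp (f a).
Proof.
move=> lf He Hi; apply: lspan_lin => // v [[w Hw ->]|Iv]; first exact: He.
by apply: lspan_gen; right; apply: Hi.
Qed.

Lemma nfsp_vP a : nfsp a -> nfsp (vP a).
Proof.
apply: (nfsp_lin (f := vP)); [exact: lin_ext | move=> w Hw | exact: idl_vP].
by rewrite /vP ext_e; apply: nfsp_e; case: w Hw => a' l Hw; apply: NFP => //; apply: NF0.
Qed.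

(* Only the junction [P(a)P(b)] can be reducible. Rewriting it puts a single letter [P(z)] between
   letters that are not [P]'s, so the induction is needed only for the products under [P]. *)
Lemma nfsp_mul_e u v : NF (wletters u) -> NF (wletters v) -> nfsp (delta (wcat u v)).
Proof.
have [n] := ubnP (wsize u + wsize v); elim: n u v => // n IH u v Hn Hu Hv.
have Ecat : wletters (wcat u v) = wletters u ++ wletters v by [].
have [J|] := boolP (endsP (wletters u) && startsP (wletters v)); last first.
  by move=> J; apply: nfsp_e; rewrite Ecat; apply: NF_cat.
case/andP: J => Ju Jv.
have [l [a [la Eu]]] : exists l a la, wletters u = rcons l (LP a la).
  move: Ju; case: u {Hn Hu Ecat} => b s; rewrite /endsP /wletters /=.
  case E: (last b s) => [//|a la|//] _; exists (belast b s), a, la.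
  by rewrite -E -lastI.
have [b [lb [r Ev]]] : exists b lb r, wletters v = LP b lb :: r.
  by move: Jv; case: v {Hn Hv Ecat} => -[x|b lb|b lb] s // _; exists b, lb, s.
pose A : word X := (a, la); pose B : word X := (b, lb).
have [Hl lastl] : NF l /\ ~~ endsP l by apply: (@NF_rconsP _ _ a la); rewrite -Eu.
have [HA _] : NF (wletters A) /\ ~~ @startsP X [::].
  by apply: (@NF_in _ l); rewrite cats1 -Eu.
have [HB headr] : NF (wletters B) /\ ~~ startsP r by apply: (@NF_in _ [::]); rewrite /= -Ev.
have Hr : NF r by apply: (@NF_behead _ (LP b lb)); rewrite -Ev.
have sub z : wletters (csubw (CinP l r (CTop [::] [::])) z) = l ++ LP z.1 z.2 :: r.
  by rewrite csubw_inP; case: (l).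
pose f : V -> V := vsub (CinP l r (CTop [::] [::])).
have fN (d : V) : nfsp d -> nfsp (f d).
  apply: (nfsp_lin (f := f)); first exact: lin_ext.
    move=> w Hw; rewrite /f /vsub ext_e; apply: nfsp_e; rewrite sub.
    apply: NF_cat; first exact: Hl; last by rewrite (negbTE lastl).
    by apply: NFP => //; case: w Hw.
  apply: idl_ctx; first exact: lin_ext.
  move=> c0; by exists (CinP l r c0) => w; rewrite /f /vsub ext_e csubw_inP.
have szu : (wsize u = sumn (map (@lsize X) l) + (wsize A).+1)%N.
  by rewrite /wsize Eu map_rcons -cats1 sumn_cat /= addn0.
have szv : (wsize v = (wsize B).+1 + sumn (map (@lsize X) r))%N by rewrite /wsize Ev /=.
have szP w : wsize (wP w) = (wsize w).+1 by rewrite /wsize /= addn0.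
have NP w : NF (wletters w) -> NF (wletters (wP w)).
  by case: w => ? ? H; apply: NFP => //; apply: NF0.
(* Each product loses at least one of the two outer P symbols at the junction, so its total size is
   smaller. *)
have N1 : nfsp (delta (wcat A (wP B))) by apply: IH => //; [rewrite szP; lia | apply: NP].
have N2 : nfsp (delta (wcat (wP A) B)) by apply: IH => //; [rewrite szP; lia | apply: NP].
have N3 : nfsp (delta (wcat A B)) by apply: IH => //; lia.
apply: (@nfsp_idl _
  (f (delta (wcat A (wP B))) + f (delta (wcat (wP A) B)) + lam *: f (delta (wcat A B)))).
  by apply: lspanD; [apply: lspanD|apply: lspanZ]; apply: fN.
have := @idl_gen (CTop l r) (rb_poly lam A B).
rewrite /gext !big_cons big_nil rule_sumE /f /vsub !ext_e !csubw_inP.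
have -> : csubw (CTop l r) (1 : K, wcat (wP A) (wP B)).2 = wcat u v.
  have inj (w w' : word X) : wletters w = wletters w' -> w = w'.
    by case: w w' => ? ? [? ?] [-> ->].
  apply: inj; rewrite Ecat Eu Ev -cats1 -catA /=.
  by case: (l).
by apply; exists A, B; left.
Qed.

Lemma nfsp_mul a b : nfsp a -> nfsp b -> nfsp (a ** b).
Proof.
move=> Ha Hb; apply: (nfsp_lin (f := fun a => a ** b)) Ha;
  [by lin_tac| |by move=> ?; apply: idl_mulr].
move=> u Hu; apply: (nfsp_lin (f := fun b => delta u ** b)) Hb;
  [by lin_tac| |by move=> ?; apply: idl_mull].
by move=> v Hv; rewrite fmul_e; apply: nfsp_mul_e.
Qed.

(** The Leibniz rule reduces to single letters: D^i x becomes D^(i+1) x, and P(u) becomes u.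
    Products of the results are handled by [nfsp_mul]. *)
Lemma nfsp_vD a : nfsp a -> nfsp (vD a).
Proof.
apply: (nfsp_lin (f := vD)); [exact: lin_ext | | exact: idl_vD].
have D1 b : NF [:: b] -> nfsp (vD (delta (b, [::]))).
  move E: [:: b] => s Hs; case: Hs E => [//|i x l' _ [-> _]|c l' l'' Hc _ _ [-> _]].
    by rewrite /vD ext_e; apply: nfsp_e; apply: (@NFD _ i.+1 x); apply: NF0.
  apply: (@nfsp_idl _ (delta (c, l'))); first exact: nfsp_e.
  by have := idl_dp (delta (c, l')); rewrite /vP ext_e.
move=> [b l]; rewrite /wletters /=; elim: l b => [|c l IH] b Hbl; first exact: D1.
have Hcl := NF_behead Hbl.
have Hb : NF [:: b] by apply: (@NF_catl _ _ (c :: l)).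
have := idl_dl (delta (b, [::])) (delta (c, l)); rewrite fmul_e; apply: nfsp_idl.
have Nb : nfsp (delta (b, [::])) by apply: nfsp_e.
have Nc : nfsp (delta (c, l)) by apply: nfsp_e.
by apply: lspanD; [apply: lspanD|apply: lspanZ]; apply: nfsp_mul => //; by [apply: D1 | apply: IH].
Qed.

Lemma nfsp_all w : nfsp (delta w).
Proof.
have step a l : nfsp (delta (a, [::])) ->
    List.Forall (fun b => nfsp (delta (b, [::]))) l -> nfsp (delta (a, l)).
  elim: l a => [//|b l IH] a Ha Hl; inversion_clear Hl.
  by rewrite -[(a, _)]/(wcat (a, [::]) (b, l)) -fmul_e; apply: nfsp_mul => //; apply: IH.
have Hlet a : nfsp (delta (a, [::])).
  elim/letter_nested_ind: a => [x|a l Ha Hl|a l Ha Hl].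
  - by apply: nfsp_e; apply: (@NFD _ 0 x); apply: NF0.
  - by have := nfsp_vP (step a l Ha Hl); rewrite /vP ext_e.
  - by have := nfsp_vD (step a l Ha Hl); rewrite /vD ext_e.
by case: w => a l; apply: step => //; elim: l => [|b l IH]; constructor.
Qed.

Lemma nfsp_poly a : nfsp a -> exists q : opoly K X,
  (forall d, List.In d q -> Phi d.2) /\ idl (a - gext delta q).
Proof.
elim=> {a} [|v [[w Hw ->]|Iv]|u v _ [p [Hp Ip]] _ [q [Hq Iq]]|k v _ [q [Hq Iq]]].
- by exists [::]; split=> //; rewrite /gext big_nil subr0; apply: lspan0.
- exists [:: (1, w)]; split; first by move=> c [<-|//]; apply/NF_Phi.
  by rewrite /gext big_seq1 scale1r subrr; apply: lspan0.
- by exists [::]; split=> //; rewrite /gext big_nil subr0.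
- exists (p ++ q); split; first by move=> c Hc; case: (In_cat Hc) => [H|H]; [apply: Hp|apply: Hq].
  by rewrite gext_cat opprD addrACA; apply: lspanD.
- exists (pscale k q); split; first by move=> c Hc; have [c' H ->] := In_map Hc; apply: (Hq c').
  by rewrite gext_scale -scalerBr; apply: lspanZ.
Qed.

Lemma Phi_spanning w : exists q : opoly K X,
  (forall a, List.In a q -> Phi a.2) /\ inId lam (psub (pword w) q).
Proof.
have [q [Hq Iq]] := nfsp_poly (nfsp_all w); exists q; split=> //.
by apply: idl_inId; rewrite gext_psub {1}/gext big_seq1 scale1r.
Qed.

End Spanning.

(** * The quotient algebra, its universal property and its basis *)

Theorem theorem6p5 (K : comPzRingType) (lam : K) (X : Type) :
  (* K<X;Omega|S> is a lambda-differential Rota-Baxter algebra: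
     the defining identities hold modulo Id(S) for all Omega-polynomials *)
  (forall u v : opoly K X,
         inId lam (psub (pmul (pP u) (pP v))
                    (padd (padd (pP (pmul u (pP v))) (pP (pmul (pP u) v)))
                          (pscale lam (pP (pmul u v)))))) /\
      (forall u v : opoly K X,
         inId lam (psub (pD (pmul u v))
                    (padd (padd (pmul (pD u) v) (pmul u (pD v)))
                          (pscale lam (pmul (pD u) (pD v)))))) /\
      (forall u : opoly K X, inId lam (psub (pD (pP u)) u)) /\
      (* it is free on X (via x |-> class of x) *)
      (forall (A : lmodType K) (mul : A -> A -> A) (P D : A -> A) (f : X -> A),
         is_lamDRB lam mul P D ->
         exists phi : word X -> A,
           [/\ quot_hom lam mul P D phi,
               (forall x, phi (wx x) = f x) &
               (forall psi : word X -> A, quot_hom lam mul P D psi ->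
                  (forall x, psi (wx x) = f x) -> forall w, psi w = phi w)]) /\
      (* Phi(D^omega(X)) spans K<X;Omega> modulo Id(S) *)
      (forall w : word X, exists q : opoly K X,
         (forall a, List.In a q -> Phi a.2) /\ inId lam (psub (pword w) q)) /\
      (* ... and is K-linearly independent modulo Id(S) *)
      (forall q : opoly K X, (forall a, List.In a q -> Phi a.2) ->
         inId lam q -> forall w, coef q w = 0).
Proof.
split=> [u v|].
  apply: idl_inId; rewrite gext_psub !gext_cat gext_scale !(gext_pmul, gext_pP).
  exact: idl_rb.
split=> [u v|].
  apply: idl_inId; rewrite gext_psub !gext_cat gext_scale !(gext_pmul, gext_pD).
  exact: idl_dl.
split=> [u|]; first by apply: idl_inId; rewrite gext_psub gext_pD gext_pP; apply: idl_dp.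
split; last by split; [exact: Phi_spanning | exact: Phi_independent].
move=> A mul P D f [mulA [lml [lmr [lP [lD [HRB [HD HDP]]]]]]].
have phiM := evw_cat P D f mulA.
(* Evaluation of words is the required map. It factors through the quotient because the three axioms
   make every element of S evaluate to 0. *)
exists (evw mul P D f); split=> [|//|psi [psiM psiP psiD _] psix w]; last exact: evw_unique.
split=> //; apply: (pext_Id (mul := mul) (P := P) (D := D)) => //.
- by move=> z k x y; apply: lml.
- by move=> z k x y; apply: lmr.
exact: (pext_inS (mul := mul) (P := P) (D := D)).
Qed.
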